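(* Let $X_1,X_2,X_3,Y$ be Banach spaces and let $f:X_1\times X_2\times X_3\to Y$ be a bounded trilinear map. The following statements are equivalent: (a) $f$ is Aron--Berner regular; (b) $f$ admits a norm preserving (trilinear) extension $F:X_1^{**}\times X_2^{**}\times X_3^{**}\to Y^{**}$ which is separately $w^*$-continuous (i.e. $w^*$-to-$w^*$ continuous in each variable when the other two are fixed); (c) $f^{\circledast *}(Y^*\times X_1^{**}\times X_2^{**})\subseteq X_3^*$ and $f^{\circledast **}(X_3^{**}\times Y^*\times X_1^{**})\subseteq X_2^*$; (d) for each $y^*\in Y^*$, the first Arens extension of the bilinear map $f^*(y^*,\cdot,\cdot):X_1\times X_2\to X_3^*$ is $X_3^*$-valued, and for every $y^*\in Y^*$ and $x_3^{**}\in X_3^{**}$ the operator $f^{**}(x_3^{**},y^*,\cdot):X_1\to X_2^*$ is weakly compact.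
   Context: Every Banach space $X$ is identified with its canonical image in its bidual $X^{**}$ (likewise $X^*\subseteq X^{***}$, etc.). For a bounded trilinear map $f:X_1\times X_2\times X_3\to Y$ the adjoint $f^*:Y^*\times X_1\times X_2\to X_3^*$ is the bounded trilinear map given by $\langle f^*(y^*,x_1,x_2),x_3\rangle=\langle y^*,f(x_1,x_2,x_3)\rangle$. Iterated adjoints are $f^{**}=(f^* )^*:X_3^{**}\times Y^*\times X_1\to X_2^*$, $f^{***}=(f^{**})^*$, and $f^{\circledast}:=f^{****}:X_1^{**}\times X_2^{**}\times X_3^{**}\to Y^{**}$, a norm preserving trilinear extension of $f$. Thus $f^{\circledast *}=(f^{\circledast})^*:Y^{***}\times X_1^{**}\times X_2^{**}\to X_3^{***}$ and $f^{\circledast **}=(f^{\circledast *})^*:X_3^{****}\times Y^{***}\times X_1^{**}\to X_2^{***}$. For $\sigma$ in the symmetric group $S_3$ on $\{1,2,3\}$, define $f^\sigma:X_{\sigma(1)}\times X_{\sigma(2)}\times X_{\sigma(3)}\to Y$ by $f^\sigma(x_{\sigma(1)},x_{\sigma(2)},x_{\sigma(3)})=f(x_1,x_2,x_3)$, and define the Aron--Berner extension $f^{\sigma\circledast\sigma^{-1}}:X_1^{**}\times X_2^{**}\times X_3^{**}\to Y^{**}$ by $f^{\sigma\circledast\sigma^{-1}}(x_1^{**},x_2^{**},x_3^{**})=(f^\sigma)^{\circledast}(x_{\sigma(1)}^{**},x_{\sigma(2)}^{**},x_{\sigma(3)}^{**})$. The map $f$ is called Aron--Berner regular if $f^{\sigma\circledast\sigma^{-1}}=f^{\circledast}$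 for every $\sigma\in S_3$. For a bounded bilinear map $h:X_1\times X_2\to Z$ the adjoint $h^*:Z^*\times X_1\to X_2^*$ is given by $\langle h^*(z^*,x_1),x_2\rangle=\langle z^*,h(x_1,x_2)\rangle$, and the first Arens extension of $h$ is $h^{***}=((h^* )^* )^*:X_1^{**}\times X_2^{**}\to Z^{**}$; it is called $Z$-valued if its range lies in (the canonical image of) $Z$. *)

(* Defs.v *)
From HB Require Import structures.
From mathcomp Require Import all_boot all_order all_algebra perm.
From mathcomp Require Import complex.
From mathcomp Require Import boolp classical_sets functions reals topology.
From mathcomp Require Import normedtype.

Set Implicit Arguments.
Unset Strict Implicit.
Unset Printing Implicit Defensive.

Import Order.TTheory GRing.Theory Num.Theory.
Import numFieldNormedType.Exports.

Local Open Scope classical_set_scope.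
Local Open Scope ring_scope.

(* The scalar field of a Banach space is either R or C = R[i]; everything
   below is uniform in that choice. *)
Variant scalar_kind := RealScalars | ComplexScalars.

Definition scalar_field (R : realType) (s : scalar_kind) : numFieldType :=
  match s with RealScalars => R | ComplexScalars => R[i] end.

Section Supremum.
Context {R : realType} {s : scalar_kind}.
Local Notation K := (scalar_field R s).

(* Norms take their values in K, so the operator norm is a supremum in K: for
   K = R[i] the order is the partial one, in which two elements are comparable
   only when they have the same imaginary part. *)
Lemma scalar_field_supremums (A : set K) (M : K) :
  A 0 -> ubound A M -> supremums A !=set0.
Proof.
case: s A M => /= A M A0 AM.
  have hA : has_sup A by split; [exists 0 | exists M].
  exists (sup A); split; first exact: sup_upper_bound.
  by move=> y Ay; apply: ge_sup => //; exists 0.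
have Im0 z : A z -> complex.Im z = 0.
  move=> Az; have /= := AM _ A0; have /= := AM _ Az.
  by rewrite !lecE => /andP[/eqP <- _] /andP[/eqP -> _].
pose B := [set complex.Re z | z in A].
have B0 : B 0 by exists 0.
have hB : has_sup B.
  split; first by exists 0.
  exists (complex.Re M) => _ [z Az <-].
  by have /= := AM _ Az; rewrite lecE => /andP[].
exists (Complex (sup B) 0); split.
  move=> z Az; rewrite lecE /= Im0// eqxx/=.
  by apply: sup_upper_bound => //; exists z.
move=> y Ay; rewrite lecE/=; apply/andP; split.
  by have /= := Ay _ A0; rewrite lecE => /andP[].
apply: ge_sup; first by exists 0.
by move=> _ [z Az <-]; have /= := Ay _ Az; rewrite lecE => /andP[].
Qed.

Lemma le_norm_bound (M u t : K) : u <= M * t -> 0 <= u -> 0 <= t ->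
  u <= `|M| * t.
Proof.
move=> uMt u0; rewrite le_eqVlt => /predU1P[t0|t0].
  by move: uMt; rewrite -t0 !mulr0.
by rewrite ger0_norm// -(pmulr_lge0 _ t0) (le_trans u0).
Qed.

End Supremum.

Section Dual.
Context {R : realType} {s : scalar_kind}.
Local Notation K := (scalar_field R s).
Implicit Types X Y : normedModType K.

Definition bounded_linear X Y (f : X -> Y) : Prop :=
  linear f /\ exists M : K, forall x, `|f x| <= M * `|x|.

Definition functionals X : {pred X -> K^o} :=
  [pred f : X -> K^o | `[< bounded_linear f >]].
Arguments functionals : clear implicits.

Lemma functionals_submod X : submod_closed (functionals X).
Proof.
split=> [|a f g].
  apply: asboolT; split=> [c u v|]; first by rewrite scaler0 addr0.
  by exists 0 => x; rewrite mul0r normr0.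
move=> /asboolW[lf [M fM]] /asboolW[lg [N gN]].
apply: asboolT; split=> [c u v|].
  rewrite !fctE lf lg !scalerDr !scalerA [a * c]mulrC.
  by rewrite -!addrA; congr (_ + _); rewrite addrCA.
exists (`|a| * M + N) => x; rewrite fctE.
rewrite (le_trans (ler_normD _ _))// mulrDl lerD//.
by rewrite normrZ -mulrA ler_wpM2l.
Qed.

HB.instance Definition _ X :=
  GRing.isSubmodClosed.Build K (X -> K^o) (functionals X)
    (functionals_submod X).

Record dual X := Dual {
  dual_fun :> X -> K^o;
  _ : dual_fun \in functionals X }.

HB.instance Definition _ X := [isSub for @dual_fun X].
HB.instance Definition _ X := [Choice of dual X by <:].
HB.instance Definition _ X := [SubChoice_isSubLmodule of dual X by <:].

Definition mk_dual X (f : X -> K^o) (bf : bounded_linear f) : dual X :=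
  Dual (asboolT bf).

Lemma dualP X (f : dual X) : bounded_linear f.
Proof. by case: f => f /= /asboolW. Qed.

Lemma dual_linear X (f : dual X) : linear f.
Proof. by case: (dualP f). Qed.

Lemma dual0 X (f : dual X) : f 0 = 0.
Proof. by rewrite -[0](addNr 0) -scaleN1r dual_linear scaleN1r addNr. Qed.

Lemma dualZ X (f : dual X) (a : K) x : f (a *: x) = a * f x.
Proof. by rewrite -[a *: x]addr0 dual_linear dual0 addr0. Qed.

Definition dual_values X (f : dual X) : set K :=
  [set `|f x| | x in [set x | `|x| <= 1]].

Definition dual_norm X (f : dual X) : K := supremum 0 (dual_values f).

Lemma dual_values0 X (f : dual X) : dual_values f 0.
Proof. by exists 0; rewrite /= ?dual0 normr0. Qed.

Lemma dual_supremums X (f : dual X) : supremums (dual_values f) !=set0.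
Proof.
case: (dualP f) => _ [M fM].
apply: (@scalar_field_supremums R s _ `|M|); first exact: dual_values0.
move=> _ [x /= x1 <-].
rewrite (le_trans (le_norm_bound (fM x) _ _))//.
by rewrite -[leRHS]mulr1 ler_wpM2l.
Qed.

Lemma dual_norm_sup X (f : dual X) : supremums (dual_values f) (dual_norm f).
Proof.
rewrite /dual_norm /supremum; case: ifPn => [/eqP V0|_].
  by have := dual_values0 f; rewrite V0.
by case: xgetP => // h; case: (dual_supremums f) => y /h.
Qed.

Lemma dual_norm_ub X (f : dual X) x : `|x| <= 1 -> `|f x| <= dual_norm f.
Proof. by move=> x1; have [+ _] := dual_norm_sup f; apply; exists x. Qed.

Lemma dual_norm_lub X (f : dual X) (M : K) :
  (forall x, `|x| <= 1 -> `|f x| <= M) -> dual_norm f <= M.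
Proof.
by move=> fM; have [_] := dual_norm_sup f; apply=> _ [x /= /fM ? <-].
Qed.

Lemma dual_norm_le X (f : dual X) x : `|f x| <= dual_norm f * `|x|.
Proof.
have [->|x0] := eqVneq x 0; first by rewrite dual0 !normr0 mulr0.
have nx : 0 < `|x| by rewrite normr_gt0.
rewrite -ler_pdivrMr// mulrC.
have -> : `|x|^-1 * `|f x| = `|f (`|x|^-1 *: x)|.
  by rewrite dualZ normrM ger0_norm// invr_ge0.
apply: dual_norm_ub.
by rewrite normrZ ger0_norm ?invr_ge0// mulVf// gt_eqF.
Qed.

Lemma dual_normD X (f g : dual X) :
  dual_norm (f + g) <= dual_norm f + dual_norm g.
Proof.
apply: dual_norm_lub => x x1; apply: (le_trans (ler_normD _ _)).
by apply: lerD; exact: dual_norm_ub.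
Qed.

Lemma dual_norm_ge0 X (f : dual X) : 0 <= dual_norm f.
Proof. by apply: (le_trans _ (@dual_norm_ub _ f 0 _)); rewrite ?normr0. Qed.

Lemma dual_norm_Zle X (a : K) (f : dual X) :
  dual_norm (a *: f) <= `|a| * dual_norm f.
Proof.
apply: dual_norm_lub => x x1; rewrite [(a *: f) x]/(a * f x) normrM.
by apply: ler_wpM2l => //; exact: dual_norm_ub.
Qed.

Lemma dual_normZ X (a : K) (f : dual X) :
  dual_norm (a *: f) = `|a| * dual_norm f.
Proof.
apply/eqP; rewrite eq_le dual_norm_Zle/=.
have [->|a0] := eqVneq a 0; first by rewrite normr0 mul0r dual_norm_ge0.
rewrite -ler_pdivlMl ?normr_gt0// -normfV.
by rewrite -{1}[f](scalerK a0) dual_norm_Zle.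
Qed.

Lemma dual_norm_eq0 X (f : dual X) : dual_norm f = 0 -> f = 0.
Proof.
move=> f0; apply/val_inj/funext => x /=; apply/eqP; rewrite -normr_le0.
by rewrite (le_trans (dual_norm_le f x))// f0 mul0r.
Qed.

HB.instance Definition _ X :=
  Lmodule_isNormed.Build K (dual X)
    (@dual_normD X) (@dual_normZ X) (@dual_norm_eq0 X).

Lemma dual_le X (f : dual X) x : `|f x| <= `|f| * `|x|.
Proof. exact: dual_norm_le. Qed.

Lemma dual_le_bound X (f : dual X) (M : K) : 0 <= M ->
  (forall x, `|f x| <= M * `|x|) -> `|f| <= M.
Proof.
move=> M0 fM; apply: dual_norm_lub => x x1.
by apply: (le_trans (fM x)); rewrite -[leRHS]mulr1 ler_wpM2l.
Qed.

Lemma dual_eqP X (f g : dual X) : f =1 g -> f = g.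
Proof. by move=> fg; apply/val_inj/funext. Qed.

End Dual.

Notation bidual X := (dual (dual X)).

Section Topologies.
Context {R : realType} {s : scalar_kind}.
Local Notation K := (scalar_field R s).
Implicit Types X Y : normedModType K.

(* The w*-topology of the dual and the weak topology of X, as topologies of
   pointwise convergence. *)
Definition weak_star X : topologicalType :=
  initial_topology (fun f : dual X => (dual_fun f : {ptws X -> K^o})).

Definition weak X : topologicalType :=
  initial_topology (fun x : X => ((fun f => f x) : {ptws dual X -> K^o})).

Definition weakly_compact X Y (T : X -> Y) : Prop :=
  compact (closure (T @` [set x | `|x| <= 1] : set (weak Y))).

Lemma eval_bounded_linear X (x : X) :
  bounded_linear (fun f : dual X => f x : K^o).
Proof.
split=> [a f g //|]; exists `|x| => f.
by rewrite mulrC dual_le.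
Qed.

Definition canon X (x : X) : bidual X := mk_dual (eval_bounded_linear x).

End Topologies.

Section Bilinear.
Context {R : realType} {s : scalar_kind}.
Local Notation K := (scalar_field R s).

Record bilinear_map (X1 X2 Z : normedModType K) := BilinearMap {
  bil_fun :> X1 -> X2 -> Z;
  bil_linear1 : forall x2, linear (fun x1 => bil_fun x1 x2);
  bil_linear2 : forall x1, linear (bil_fun x1);
  bil_bounded : exists M : K, forall x1 x2,
    `|bil_fun x1 x2| <= M * (`|x1| * `|x2|) }.

Variables (X1 X2 Z : normedModType K) (h : bilinear_map X1 X2 Z).

Lemma bil_bound : exists2 M : K, 0 <= M &
  forall x1 x2, `|h x1 x2| <= M * (`|x1| * `|x2|).
Proof.
have [M hM] := bil_bounded h; exists `|M| => // x1 x2.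
by rewrite le_norm_bound// mulr_ge0.
Qed.

Lemma bil_adj_bounded_linear (z : dual Z) (x1 : X1) :
  bounded_linear (fun x2 => z (h x1 x2) : K^o).
Proof.
split=> [a u v|]; first by rewrite bil_linear2 dual_linear.
have [M M0 hM] := bil_bound; exists (`|z| * (M * `|x1|)) => x2.
by rewrite (le_trans (dual_le _ _))// -!mulrA ler_wpM2l.
Qed.

Definition bil_adj_fun z x1 : dual X2 := mk_dual (bil_adj_bounded_linear z x1).

Lemma bil_adj_linear1 x1 : linear (fun z => bil_adj_fun z x1).
Proof. by move=> a u v; exact: dual_eqP. Qed.

Lemma bil_adj_linear2 z : linear (bil_adj_fun z).
Proof.
by move=> a u v; apply: dual_eqP => x2; rewrite /= bil_linear1 dual_linear.
Qed.

Lemma bil_adj_bounded : exists M : K, forall z x1,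
  `|bil_adj_fun z x1| <= M * (`|z| * `|x1|).
Proof.
have [M M0 hM] := bil_bound; exists M => z x1.
apply: dual_le_bound => [|x2]; first by rewrite !mulr_ge0.
by rewrite (le_trans (dual_le z _))// -!mulrA mulrCA ler_wpM2l.
Qed.

(* <h^*(z, x1), x2> = <z, h(x1, x2)>. *)
Definition bil_adj : bilinear_map (dual Z) X1 (dual X2) :=
  BilinearMap bil_adj_linear1 bil_adj_linear2 bil_adj_bounded.

End Bilinear.

Section Arens.
Context {R : realType} {s : scalar_kind}.
Local Notation K := (scalar_field R s).
Variables (X1 X2 Z : normedModType K).

Definition first_arens (h : bilinear_map X1 X2 Z) :
    bilinear_map (bidual X1) (bidual X2) (bidual Z) :=
  bil_adj (bil_adj (bil_adj h)).

Definition first_arens_valued (h : bilinear_map X1 X2 Z) : Prop :=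
  forall x1 x2, exists z : Z, first_arens h x1 x2 = canon z.

End Arens.

Section Trilinear.
Context {R : realType} {s : scalar_kind}.
Local Notation K := (scalar_field R s).

Record trilinear_map (X1 X2 X3 Y : normedModType K) := TrilinearMap {
  tri_fun :> X1 -> X2 -> X3 -> Y;
  tri_linear1 : forall x2 x3, linear (fun x1 => tri_fun x1 x2 x3);
  tri_linear2 : forall x1 x3, linear (fun x2 => tri_fun x1 x2 x3);
  tri_linear3 : forall x1 x2, linear (tri_fun x1 x2);
  tri_bounded : exists M : K, forall x1 x2 x3,
    `|tri_fun x1 x2 x3| <= M * (`|x1| * `|x2| * `|x3|) }.

Variables (X1 X2 X3 Y : normedModType K) (f : trilinear_map X1 X2 X3 Y).

Definition tri_values : set K :=
  [set r | exists x1 x2 x3,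
    [/\ `|x1| <= 1, `|x2| <= 1, `|x3| <= 1 & r = `|f x1 x2 x3|]].

Definition tri_norm : K := supremum 0 tri_values.

Lemma tri_bound : exists2 M : K, 0 <= M &
  forall x1 x2 x3, `|f x1 x2 x3| <= M * (`|x1| * `|x2| * `|x3|).
Proof.
have [M fM] := tri_bounded f; exists `|M| => // x1 x2 x3.
by rewrite le_norm_bound// !mulr_ge0.
Qed.

Lemma tri_norm_sup : supremums tri_values tri_norm.
Proof.
have [M M0 fM] := tri_bound.
have V0 : tri_values 0.
  have f0 : f 0 0 0 = 0.
    by rewrite -[X in f _ _ X](addNr 0) -scaleN1r tri_linear3 scaleN1r addNr.
  by exists 0, 0, 0; rewrite f0 !normr0.
have VM : ubound tri_values M.
  move=> _ [x1 [x2 [x3 [b1 b2 b3 ->]]]]; rewrite (le_trans (fM _ _ _))//.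
  by rewrite -[leRHS]mulr1 ler_wpM2l// mulr_ile1// ?mulr_ge0// mulr_ile1.
rewrite /tri_norm /supremum; case: ifPn => [/eqP E|_].
  by move: V0; rewrite E.
by case: xgetP => // h; case: (scalar_field_supremums V0 VM) => y /h.
Qed.

Lemma tri_adj_bounded_linear (y : dual Y) (x1 : X1) (x2 : X2) :
  bounded_linear (fun x3 => y (f x1 x2 x3) : K^o).
Proof.
split=> [a u v|]; first by rewrite tri_linear3 dual_linear.
have [M M0 fM] := tri_bound; exists (`|y| * (M * (`|x1| * `|x2|))) => x3.
rewrite (le_trans (dual_le _ _))// -mulrA ler_wpM2l//.
by rewrite (le_trans (fM _ _ _))// !mulrA.
Qed.

Definition tri_adj_fun y x1 x2 : dual X3 :=
  mk_dual (tri_adj_bounded_linear y x1 x2).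

Lemma tri_adj_linear1 x1 x2 : linear (fun y => tri_adj_fun y x1 x2).
Proof. by move=> a u v; exact: dual_eqP. Qed.

Lemma tri_adj_linear2 y x2 : linear (fun x1 => tri_adj_fun y x1 x2).
Proof.
by move=> a u v; apply: dual_eqP => x3; rewrite /= tri_linear1 dual_linear.
Qed.

Lemma tri_adj_linear3 y x1 : linear (tri_adj_fun y x1).
Proof.
by move=> a u v; apply: dual_eqP => x3; rewrite /= tri_linear2 dual_linear.
Qed.

Lemma tri_adj_bounded : exists M : K, forall y x1 x2,
  `|tri_adj_fun y x1 x2| <= M * (`|y| * `|x1| * `|x2|).
Proof.
have [M M0 fM] := tri_bound; exists M => y x1 x2.
apply: dual_le_bound => [|x3]; first by rewrite !mulr_ge0.
rewrite (le_trans (dual_le y _))// -!mulrA mulrCA ler_wpM2l//.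
by rewrite (le_trans (fM _ _ _))// -!mulrA.
Qed.

(* <f^*(y, x1, x2), x3> = <y, f(x1, x2, x3)>. *)
Definition tri_adj : trilinear_map (dual Y) X1 X2 (dual X3) :=
  TrilinearMap tri_adj_linear1 tri_adj_linear2 tri_adj_linear3
    tri_adj_bounded.

Lemma tri_fix1_bounded x1 : exists M : K, forall x2 x3,
  `|f x1 x2 x3| <= M * (`|x2| * `|x3|).
Proof.
have [M _ fM] := tri_bound; exists (M * `|x1|) => x2 x3.
by rewrite (le_trans (fM _ _ _))// -!mulrA.
Qed.

(* The bilinear map f(x1, ., .). *)
Definition tri_fix1 (x1 : X1) : bilinear_map X2 X3 Y :=
  BilinearMap (tri_linear2 f x1) (tri_linear3 f x1) (tri_fix1_bounded x1).

End Trilinear.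

Section AronBerner.
Context {R : realType} {s : scalar_kind}.
Local Notation K := (scalar_field R s).

Definition tri_ext (X1 X2 X3 Y : normedModType K)
    (f : trilinear_map X1 X2 X3 Y) :
    trilinear_map (bidual X1) (bidual X2) (bidual X3) (bidual Y) :=
  tri_adj (tri_adj (tri_adj (tri_adj f))).

Section Swaps.
Variables (X1 X2 X3 Y : normedModType K) (f : trilinear_map X1 X2 X3 Y).

Lemma tri_swap12_bounded : exists M : K, forall x2 x1 x3,
  `|f x1 x2 x3| <= M * (`|x2| * `|x1| * `|x3|).
Proof.
by have [M _ fM] := tri_bound f; exists M => *; rewrite (mulrC `|_| `|_|).
Qed.

Definition tri_swap12 : trilinear_map X2 X1 X3 Y :=
  TrilinearMap (fun x1 x3 => tri_linear2 f x1 x3)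
    (fun x2 x3 => tri_linear1 f x2 x3) (fun x2 x1 => tri_linear3 f x1 x2)
    tri_swap12_bounded.

Lemma tri_swap23_bounded : exists M : K, forall x1 x3 x2,
  `|f x1 x2 x3| <= M * (`|x1| * `|x3| * `|x2|).
Proof.
by have [M _ fM] := tri_bound f; exists M => *; rewrite mulrAC.
Qed.

Definition tri_swap23 : trilinear_map X1 X3 X2 Y :=
  TrilinearMap (fun x3 x2 => tri_linear1 f x2 x3)
    (fun x1 x2 => tri_linear3 f x1 x2) (fun x1 x3 => tri_linear2 f x1 x3)
    tri_swap23_bounded.

End Swaps.

Definition separately_weak_star_continuous
    (X1 X2 X3 Y : normedModType K)
    (F : trilinear_map (dual X1) (dual X2) (dual X3) (dual Y)) : Prop :=
  [/\ forall x2 x3,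
        continuous ((fun x1 => F x1 x2 x3) : weak_star X1 -> weak_star Y),
      forall x1 x3,
        continuous ((fun x2 => F x1 x2 x3) : weak_star X2 -> weak_star Y) &
      forall x1 x2,
        continuous ((fun x3 => F x1 x2 x3) : weak_star X3 -> weak_star Y)].

(* X1, X2, X3 as a family indexed by 'I_3 = {0, 1, 2}. *)
Definition space3_nat (X1 X2 X3 : normedModType K) (i : nat) :
    normedModType K :=
  match i with 0%N => X1 | 1%N => X2 | _ => X3 end.

Definition space3 X1 X2 X3 (i : 'I_3) := space3_nat X1 X2 X3 i.

Definition triple (G : normedModType K -> Type) X1 X2 X3
    (x1 : G X1) (x2 : G X2) (x3 : G X3) (i : 'I_3) : G (space3 X1 X2 X3 i) :=
  match nat_of_ord i as k return G (space3_nat X1 X2 X3 k) with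
  | 0%N => x1 | 1%N => x2 | _ => x3
  end.

Definition i0 : 'I_3 := @Ordinal 3 0 isT.
Definition i1 : 'I_3 := @Ordinal 3 1 isT.
Definition i2 : 'I_3 := @Ordinal 3 2 isT.

Section Permuted.
Variables (X1 X2 X3 Y : normedModType K) (f : trilinear_map X1 X2 X3 Y).
Local Notation X := (space3 X1 X2 X3).

Lemma tri_perm_exists (i j k : 'I_3) : uniq [:: i; j; k] ->
  exists g : trilinear_map (X i) (X j) (X k) Y,
    forall x : (forall l, X l), g (x i) (x j) (x k) = f (x i0) (x i1) (x i2).
Proof.
have ordE (x : forall l, X l) (m : nat) (p q : (m < 3)%N) :
    x (Ordinal p) = x (Ordinal q) :> space3_nat X1 X2 X3 m.
  by rewrite (bool_irrelevance p q).
case: i => [[|[|[|?]]] ?] //; case: j => [[|[|[|?]]] ?] //;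
  case: k => [[|[|[|?]]] ?] // _;
  [ exists f | exists (tri_swap23 f)
  | exists (tri_swap12 f) | exists (tri_swap23 (tri_swap12 f))
  | exists (tri_swap12 (tri_swap23 f))
  | exists (tri_swap12 (tri_swap23 (tri_swap12 f))) ] => x;
  (congr (tri_fun f _ _ _);
  [exact: (ordE x 0%N) | exact: (ordE x 1%N) | exact: (ordE x 2%N)]).
Qed.

Lemma tri_perm_uniq (sigma : 'S_3) : uniq [:: sigma i0; sigma i1; sigma i2].
Proof. by rewrite /= !inE !(inj_eq perm_inj). Qed.

(* f^sigma, the map determined by
   f^sigma(x_sigma(1), x_sigma(2), x_sigma(3)) = f(x_1, x_2, x_3). *)
Definition tri_perm (sigma : 'S_3) :
    trilinear_map (X (sigma i0)) (X (sigma i1)) (X (sigma i2)) Y :=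
  projT1 (cid (tri_perm_exists (tri_perm_uniq sigma))).

Lemma tri_permE (sigma : 'S_3) (x : forall l, X l) :
  tri_perm sigma (x (sigma i0)) (x (sigma i1)) (x (sigma i2)) =
  f (x i0) (x i1) (x i2).
Proof. by rewrite /tri_perm; case: cid. Qed.

Definition aron_berner_ext (sigma : 'S_3) (x1 : bidual X1) (x2 : bidual X2)
    (x3 : bidual X3) : bidual Y :=
  let x := triple (G := fun Z => bidual Z) x1 x2 x3 in
  tri_ext (tri_perm sigma) (x (sigma i0)) (x (sigma i1)) (x (sigma i2)).

Definition aron_berner_regular : Prop :=
  forall sigma x1 x2 x3, aron_berner_ext sigma x1 x2 x3 = tri_ext f x1 x2 x3.

End Permuted.
End AronBerner.

(* Main.v *)
From HB Require Import structures.
From mathcomp Require Import all_boot all_order all_algebra perm complex.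
From mathcomp Require Import boolp classical_sets functions reals topology.
From mathcomp Require Import normedtype.
From mathcomp Require Import ring lra.
Require Import Defs.

Set Implicit Arguments.
Unset Strict Implicit.
Unset Printing Implicit Defensive.

Import Order.TTheory GRing.Theory Num.Theory.
Import numFieldNormedType.Exports.

Local Open Scope classical_set_scope.
Local Open Scope ring_scope.

(** The theorem reduces to one property of the extension f^⊛: separate
    w*-continuity. A linear functional on a bidual X^** is w*-continuous exactly
    when it is evaluation at some element of X^* (weak_star_continuous_eval), so
    F : X1^** * X2^** * X3^** -> Y^** is separately w*-continuous iff, for every
    y^* and in each variable, <F(x1, x2, x3), y^*> is evaluation at an element
    of X_i^*: the property separately_evaluation.

    Two evaluations that agree on the canonical image of X agree everywhere.
    Comparing variable by variable, an extension of f with this property is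
    therefore f^⊛, which is always an evaluation in its first variable, in its
    second when the first is canonical, and in its third when the first two are
    (tri_ext_unique).
    - If f^⊛ has the property, then so does each (f^sigma)^⊛ up to reordering
      the variables, and uniqueness gives regularity. Conversely,
      (f^sigma)^⊛ is always an evaluation in the variable sigma(1), and sigma(1)
      is arbitrary (regular_separately_evaluation).
    - The two inclusions of condition (c) spell out the property in the third
      and in the second variable (adjoints_canonicalP).
    - The second half of (d) is Gantmacher's theorem (weakly_compactP): an
      operator T : X -> Y is weakly compact iff T^** maps X^** into Y. It is
      applied to T = f^**(x3, y, .), whose second transpose is
      f^⊛**(x3, y, .) (adjoints_canonical_weakly_compactP).

    Gantmacher's theorem rests on the Banach-Alaoglu theorem
    (dual_ball_compact) in one direction and on Goldstine's theorem (goldstine)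
    in the other. Both it and the equality of the norms of f and f^⊛ need the
    canonical embedding to be isometric (canon_norm), which is the Hahn-Banach
    theorem. *)

(** * Real and complex scalars *)

Section Scalars.
Context {R : realType} {s : scalar_kind}.
Local Notation K := (scalar_field R s).

Definition ofR : R -> K :=
  match s return R -> scalar_field R s with
  | RealScalars => fun r => r
  | ComplexScalars => fun r => Complex r 0
  end.

Definition re : K -> R :=
  match s return scalar_field R s -> R with
  | RealScalars => fun z => z
  | ComplexScalars => fun z => complex.Re z
  end.

Definition im : K -> R :=
  match s return scalar_field R s -> R with
  | RealScalars => fun z => 0
  | ComplexScalars => fun z => complex.Im z
  end.

(** The value 0 in the real case makes the decomposition
    z = re z + im z * imag_unit hold for both scalar fields. *)
Definition imag_unit : K :=
  match s return scalar_field R s with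
  | RealScalars => 0
  | ComplexScalars => Complex 0 1
  end.

Definition cj : K -> K :=
  match s return scalar_field R s -> scalar_field R s with
  | RealScalars => fun z => z
  | ComplexScalars => @conjc R
  end.

Lemma ofR_additive : zmod_morphism ofR.
Proof.
by rewrite /ofR; case: s => // a b; exact: (rmorphB (real_complex R)).
Qed.

Lemma ofR_multiplicative : monoid_morphism ofR.
Proof.
by rewrite /ofR; case: s; split => // a b; exact: (rmorphM (real_complex R)).
Qed.

HB.instance Definition _ := GRing.isZmodMorphism.Build R K ofR ofR_additive.
HB.instance Definition _ :=
  GRing.isMonoidMorphism.Build R K ofR ofR_multiplicative.

Lemma re_additive : zmod_morphism re.
Proof. by rewrite /re; case: s => //= -[a b] [c d]. Qed.

HB.instance Definition _ := GRing.isZmodMorphism.Build K R re re_additive.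

Lemma scalarE z : z = ofR (re z) + ofR (im z) * imag_unit.
Proof.
rewrite /ofR /re /im /imag_unit; case: s z => /= [z|z].
  by rewrite mulr0 addr0.
by rewrite {1}(complexE z) mulrC.
Qed.

Lemma re_ofR r : re (ofR r) = r.
Proof. by rewrite /ofR /re; case: s. Qed.

Lemma re_ofRM r z : re (ofR r * z) = r * re z.
Proof.
by rewrite /ofR /re; case: s z => //= -[a b] /=; rewrite mul0r subr0.
Qed.

Lemma ofR_le : {mono ofR : a b / a <= b}.
Proof. by rewrite /ofR; case: s => //= a b; rewrite lecE /= eqxx. Qed.

Lemma ofR_lt : {mono ofR : a b / a < b}.
Proof. exact: leW_mono ofR_le. Qed.

Lemma ge0_ofR z : 0 <= z -> ofR (re z) = z.
Proof.
rewrite /ofR /re; case: s z => //= -[a b].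
by rewrite lecE /= => /andP[/eqP -> _].
Qed.

Lemma norm_ofR r : `|ofR r| = ofR `|r|.
Proof.
rewrite /ofR; case: s => //=.
by rewrite normc_def /= expr0n /= addr0 sqrtr_sqr.
Qed.

Lemma re_le_norm z : ofR `|re z| <= `|z|.
Proof.
rewrite /ofR /re; case: s z => [z|z] //.
rewrite normc_def lecE /= eqxx /=.
by rewrite -sqrtr_sqr ler_wsqrtr// lerDl sqr_ge0.
Qed.

Lemma im_le_norm z : ofR `|im z| <= `|z|.
Proof.
rewrite /ofR /im; case: s z => [z|z]; first by rewrite normr0.
rewrite normc_def lecE /= eqxx /=.
by rewrite -sqrtr_sqr ler_wsqrtr// lerDr sqr_ge0.
Qed.

Lemma imag_unitP : imag_unit = 0 \/ imag_unit * imag_unit = -1.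
Proof. by rewrite /imag_unit; case: s; [left|right; exact: (sqr_i R)]. Qed.

Lemma re_ofR_imag r : re (ofR r * imag_unit) = 0.
Proof.
by rewrite re_ofRM /re /imag_unit; case: s; rewrite mulr0.
Qed.

Lemma re_sqr_norm (z : K) : re `|z| ^+ 2 = re z ^+ 2 + im z ^+ 2.
Proof.
rewrite /re /im; case: s z => z.
  by rewrite expr0n addr0 real_normK ?num_real.
by rewrite normc_def /= sqr_sqrtr// addr_ge0 ?sqr_ge0.
Qed.

Lemma sqr_normB (t : R) (v w : K) :
  re `|v - ofR t * w| ^+ 2 =
  re `|v| ^+ 2 - 2 * t * re (cj v * w) + t ^+ 2 * re `|w| ^+ 2.
Proof.
rewrite !re_sqr_norm /re /im /ofR /cj; case: s v w => /= [v w|[a b] [c d]] /=.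
  by ring.
by rewrite !mul0r; ring.
Qed.

Lemma cj_mul_norm (v : K) : re (cj v * v) = re `|v| ^+ 2.
Proof.
rewrite re_sqr_norm /re /im /cj; case: s v => /= [v|[a b]] /=; ring.
Qed.

Lemma re_norm_le (V : normedZmodType K) (x : V) (r : R) :
  (re `|x| <= r) = (`|x| <= ofR r).
Proof. by rewrite -ofR_le ge0_ofR. Qed.

Lemma ofR_re_norm (V : normedZmodType K) (x : V) : ofR (re `|x|) = `|x|.
Proof. by rewrite ge0_ofR. Qed.

Lemma ofR_continuous : continuous (ofR : R^o -> K^o).
Proof.
move=> r; apply/cvgrPdist_lt => e e0; near=> t.
rewrite -rmorphB norm_ofR -(ge0_ofR (ltW e0)) ofR_lt.
near: t; apply: cvgr_dist_lt => //.
by rewrite -ofR_lt rmorph0 ge0_ofR// ltW.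
Unshelve. all: by end_near. Qed.

(** The disc is a closed subset of the continuous image of a real square. *)
Lemma disc_compact (M : K) : compact [set z : K^o | `|z| <= M].
Proof.
pose C := [set z : K^o | `|z| <= M]; rewrite -/C.
pose J : set R^o := [set` `[- re M, re M]].
pose h (p : R^o * R^o) : K^o := ofR p.1 + ofR p.2 * imag_unit.
have hc : continuous h.
  move=> p; apply: cvgD.
    apply: (continuous_comp (f := fst)); first exact: cvg_fst.
    exact: ofR_continuous.
  apply: cvgMl; apply: (continuous_comp (f := snd)); first exact: cvg_snd.
  exact: ofR_continuous.
have clC : closed C.
  move=> z clz; have [w0 [w0M _]] := clz setT filterT.
  have M0 : 0 <= M by exact: le_trans (normr_ge0 w0) w0M.
  rewrite /C /= real_leNgt ?normr_real ?ger0_real//; apply/negP => Mz.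
  have e0 : 0 < `|z| - M by rewrite subr_gt0.
  have [w [/= wM]] := clz _ (nbhsx_ballx z (`|z| - M) e0).
  rewrite -ball_normE /= => zw; suff : `|z| < `|z| by rewrite ltxx.
  rewrite -{1}(subrK w z); apply: (le_lt_trans (ler_normD _ _)).
  by rewrite -[ltRHS](subrK M) ltr_leD.
apply: (subclosed_compact clC (B := h @` (J `*` J))).
  apply: continuous_compact; first exact: continuous_subspaceT.
  by apply: compact_setX; exact: segment_compact.
move=> z /= zM; have M0 : 0 <= M by exact: le_trans (normr_ge0 z) zM.
exists (re z, im z); last by rewrite [RHS]scalarE.
have reM u : (u <= re M) = (ofR u <= M) by rewrite -ofR_le ge0_ofR.
rewrite /J; split => /=; rewrite in_itv /= -ler_norml reM.
  by apply: le_trans zM; exact: re_le_norm.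
by apply: le_trans zM; exact: im_le_norm.
Qed.

End Scalars.

(** * Hahn-Banach theorem *)

Section Sublinear.
Context {R : realType} {s : scalar_kind}.
Local Notation K := (scalar_field R s).
Variable V : lmodType K.
Implicit Types (q : V -> R) (x y : V) (t : R).

(** Homogeneity is asked for real scalars only: real linear functionals are
    built first and made complex at the end. *)
Definition sublinear q : Prop :=
  (forall x y, q (x + y) <= q x + q y) /\
  (forall t x, 0 < t -> q (ofR t *: x) = t * q x).

Lemma sublinear0 q : sublinear q -> q 0 = 0.
Proof.
by case=> _ /(_ 2 0 ltac:(by [])); rewrite scaler0; lra.
Qed.

Lemma sublinear_ge q x : sublinear q -> - q (- x) <= q x.
Proof.
by move=> sq; have := sq.1 x (- x); rewrite subrr sublinear0//; lra.
Qed.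

Lemma sublinear_of_le q :
  (forall x y, q (x + y) <= q x + q y) ->
  (forall t x, 0 < t -> q (ofR t *: x) <= t * q x) -> sublinear q.
Proof.
move=> qD qZ; split=> // t x t0; apply/eqP; rewrite eq_le qZ//=.
have ti : 0 < t^-1 by rewrite invr_gt0.
have := qZ _ (ofR t *: x) ti.
rewrite scalerA -rmorphM mulVf ?gt_eqF// rmorph1 scale1r.
by rewrite -(ler_pM2l t0) mulrA mulfV ?gt_eqF// mul1r.
Qed.

(** Lowers q to a sublinear functional whose value at -y is at most -q(y). This
    serves twice: a minimal q equals all its tilts, which makes it additive, and
    tilting the norm at y forces the linear functionals below it to attain
    |y|. *)
Definition tilt q y x : R :=
  inf [set q (x + ofR t *: y) - t * q y | t in [set t | 0 <= t]].

Section Tilt.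
Variables (q : V -> R) (y : V).
Hypothesis sq : sublinear q.

Lemma sublinearZ t x : 0 <= t -> q (ofR t *: x) = t * q x.
Proof.
rewrite le_eqVlt => /predU1P[<-|t0]; last by rewrite sq.2.
by rewrite rmorph0 scale0r sublinear0// mul0r.
Qed.

Lemma tilt_le x t : 0 <= t -> tilt q y x <= q (x + ofR t *: y) - t * q y.
Proof.
move=> t0; apply: ge_inf; last by exists t.
exists (- q (- x)) => _ [r r0 <-].
have := sq.1 (x + ofR r *: y) (- x).
by rewrite addrAC subrr add0r sublinearZ//; lra.
Qed.

Lemma tilt_glb x m :
  (forall t, 0 <= t -> m <= q (x + ofR t *: y) - t * q y) -> m <= tilt q y x.
Proof.
move=> mq; apply: lb_le_inf.
  by exists (q (x + ofR 0 *: y) - 0 * q y), 0 => /=.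
by move=> _ [t t0 <-]; exact: mq.
Qed.

Lemma tilt_sublinear : sublinear (tilt q y).
Proof.
apply: sublinear_of_le => [x x'|r x r0].
  rewrite -lerBlDr; apply: tilt_glb => t t0.
  rewrite lerBlDr [leRHS]addrC -lerBlDr; apply: tilt_glb => t' t'0.
  rewrite lerBlDr; apply: (le_trans (tilt_le _ (addr_ge0 t0 t'0))).
  have -> : x + x' + ofR (t + t') *: y =
      (x + ofR t *: y) + (x' + ofR t' *: y).
    by rewrite rmorphD scalerDl addrACA.
  by have := sq.1 (x + ofR t *: y) (x' + ofR t' *: y); lra.
rewrite mulrC -ler_pdivrMr//; apply: tilt_glb => t t0.
rewrite ler_pdivrMr//.
apply: (le_trans (tilt_le _ (mulr_ge0 (ltW r0) t0))).
by rewrite rmorphM -scalerA -scalerDr sq.2//; lra.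
Qed.

Lemma tilt_le_id x : tilt q y x <= q x.
Proof.
by have := tilt_le x (lexx 0); rewrite rmorph0 scale0r addr0 mul0r subr0.
Qed.

Lemma tilt_opp : tilt q y (- y) <= - q y.
Proof.
by have := tilt_le (- y) ler01; rewrite rmorph1 scale1r addNr sublinear0//; lra.
Qed.

End Tilt.

Section Minimal.
Variable p : V -> R.
Hypothesis sp : sublinear p.

Definition dominated q : Prop := sublinear q /\ forall x, q x <= p x.

Definition dominated_sublinear := {q : V -> R | dominated q}.

(** A pointwise infimum of sublinear functionals need not be subadditive; on a
    chain it is, since any two members can be replaced by the smaller one. *)
Lemma chain_inf_sublinear (A : set dominated_sublinear)
    (q0 : dominated_sublinear) :
  A q0 ->
  (forall a b, A a -> A b ->
    (forall x, sval a x <= sval b x) \/ (forall x, sval b x <= sval a x)) ->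
  let i x := inf [set sval a x | a in A] in
  sublinear i /\ forall a, A a -> forall x, i x <= sval a x.
Proof.
move=> Aq0 totA i.
have ile (q : dominated_sublinear) x : A q -> i x <= sval q x.
  move=> Aq; apply: ge_inf; last by exists q.
  exists (- p (- x)) => _ [r Ar <-]; have [sr rp] := svalP r.
  by have := sublinear_ge x sr; have := rp (- x); lra.
have iglb x m : (forall a, A a -> m <= sval a x) -> m <= i x.
  move=> mq; apply: lb_le_inf; first by exists (sval q0 x), q0.
  by move=> _ [q Aq <-]; exact: mq.
split; last by move=> q Aq x; exact: ile.
apply: sublinear_of_le => [x y|t x t0].
  rewrite -lerBlDr; apply: (iglb _ _) => q Aq.
  rewrite lerBlDr [leRHS]addrC -lerBlDr.
  apply: (iglb _ _) => q' Aq'; rewrite lerBlDr.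
  have [qq'|q'q] := totA _ _ Aq Aq'.
    have := ile _ (x + y) Aq; have := (svalP q).1.1 x y; have := qq' y; lra.
  have := ile _ (x + y) Aq'; have := (svalP q').1.1 x y; have := q'q x; lra.
rewrite mulrC -ler_pdivrMr//; apply: (iglb _ _) => q Aq; rewrite ler_pdivrMr//.
by apply: (le_trans (ile _ _ Aq)); rewrite (svalP q).1.2// mulrC.
Qed.

Lemma minimal_sublinear : exists q : V -> R,
  [/\ sublinear q, forall x, q x <= p x &
    forall r, sublinear r -> (forall x, r x <= q x) -> r =1 q].
Proof.
pose rel (q r : dominated_sublinear) := `[< forall x, sval r x <= sval q x >].
have [q|a b c /asboolP ab /asboolP bc|a b /asboolP ab /asboolP ba
    |A totA|q qmax] := @Zorn dominated_sublinear rel.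
- by apply/asboolP.
- by apply/asboolP => x; exact: le_trans (bc x) (ab x).
- case: a b ab ba => [a sa] [b sb] /= ab ba.
  have E : a = b by apply/funext => x; apply/eqP; rewrite eq_le ab ba.
  by subst b; congr exist; exact: Prop_irrelevance.
- have [A0|/set0P[q0 Aq0]] := eqVneq A set0.
    have pp : dominated p by [].
    by exists (exist dominated p pp) => q; rewrite A0.
  have [|si iA] := chain_inf_sublinear Aq0.
    move=> q q' Aq Aq'.
    by have [/asboolP ?|/asboolP ?] := totA _ _ Aq Aq'; [right|left].
  have ip x : inf [set sval a x | a in A] <= p x.
    by apply: le_trans (iA _ Aq0 x) _; exact: (svalP q0).2.
  exists (exist dominated _ (conj si ip)) => q Aq; apply/asboolP => x /=.
  exact: iA.
exists (sval q); split; [exact: (svalP q).1|exact: (svalP q).2|].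
move=> r sr rq x.
have rp z : r z <= p z by apply: le_trans (rq z) _; exact: (svalP q).2.
have <- // : exist dominated r (conj sr rp) = q.
by apply: qmax; apply/asboolP.
Qed.

(** A minimal sublinear u satisfies u <= tilt u y, hence, with t = 1 in the tilt,
    u x + u y <= u (x + y), so it is additive. *)
Lemma linear_dominated : exists u : V -> R,
  [/\ {morph u : x y / x + y}, forall t x, u (ofR t *: x) = t * u x &
    forall x, u x <= p x].
Proof.
have [u [su up umin]] := minimal_sublinear.
have uD : {morph u : x y / x + y}.
  move=> x y; apply/eqP; rewrite eq_le su.1/=.
  have := umin _ (tilt_sublinear y su) (tilt_le_id y su) x.
  have := tilt_le y su x ler01; rewrite rmorph1 scale1r; lra.
exists u; split => // t x.
have [t0|t0] := leP 0 t; first exact: sublinearZ.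
have uN z : u (- z) = - u z.
  by apply/eqP; rewrite -addr_eq0 -uD addNr sublinear0.
rewrite -[t]opprK rmorphN scaleNr uN su.2 ?oppr_gt0//; lra.
Qed.

End Minimal.

End Sublinear.

Section HahnBanach.
Context {R : realType} {s : scalar_kind}.
Local Notation K := (scalar_field R s).
Variable X : normedModType K.

Lemma norm_sublinear : sublinear (fun x : X => re `|x|).
Proof.
split=> [x y|t x t0].
  by rewrite re_norm_le rmorphD /= !ofR_re_norm ler_normD.
by rewrite normrZ norm_ofR ger0_norm ?ltW// re_ofRM.
Qed.

(** The functional is u x - i u(i x). Multiplying x by the scalar of modulus 1
    that makes its value real and nonnegative transfers the bound from u. *)
Lemma complexify (u : X -> R) :
  {morph u : x y / x + y} -> (forall t x, u (ofR t *: x) = t * u x) ->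
  (forall x, u x <= re `|x|) ->
  exists g : dual X, `|g| <= 1 /\ forall x, re (g x) = u x.
Proof.
move=> uD uZ ule; pose I : K := imag_unit.
pose g x : K := ofR (u x) - ofR (u (I *: x)) * I.
have gD x y : g (x + y) = g x + g y.
  by rewrite /g scalerDr !uD !rmorphD /=; ring.
have gR t x : g (ofR t *: x) = ofR t * g x.
  by rewrite /g scalerA [I * _]mulrC -scalerA !uZ !rmorphM /=; ring.
have u0 : u 0 = 0 by rewrite -(scale0r (0 : X)) -(rmorph0 ofR) uZ mul0r.
have gI x : g (I *: x) = I * g x.
  rewrite /g /I; have [->|II] := imag_unitP (R := R) (s := s).
    by rewrite scale0r u0 rmorph0 mulr0 mul0r subr0.
  rewrite scalerA II scaleN1r.
  have -> : u (- x) = - u x.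
    by rewrite -scaleN1r -(rmorph1 ofR) -rmorphN uZ mulN1r.
  by rewrite rmorphN /= mulrBr mulrCA II; ring.
have gZ a x : g (a *: x) = a * g x.
  rewrite (scalarE a) scalerDl gD -scalerA !gR gI /I; ring.
have reg x : re (g x) = u x by rewrite /g raddfB /= re_ofR re_ofR_imag subr0.
have gle x : `|g x| <= 1 * `|x|.
  rewrite mul1r; have [->|gx0] := eqVneq (g x) 0; first by rewrite normr0.
  pose w := `|g x| / g x.
  have w1 : `|w| = 1 by rewrite normrM normfV normr_id mulfV// normr_eq0.
  have gw : g (w *: x) = `|g x| by rewrite gZ divfK.
  rewrite -(ofR_re_norm x) -(ofR_re_norm (g x)) ofR_le.
  by have := ule (w *: x); rewrite -reg gw normrZ w1 mul1r.
have bg : @bounded_linear R s X K^o g.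
  by split=> [a x y|]; [rewrite gD gZ|exists 1].
by exists (mk_dual bg); split; [apply: dual_le_bound|].
Qed.

(** A linear functional below the norm tilted at x is at most -|x| at -x, hence
    at least |x| at x. *)
Lemma norming_functional (x : X) :
  exists g : dual X, `|g| <= 1 /\ `|x| <= `|g x|.
Proof.
have sn := norm_sublinear.
have [u [uD uZ ule]] := linear_dominated (tilt_sublinear x sn).
have ule1 z := le_trans (ule z) (tilt_le_id x sn z).
have [g [g1 gu]] := complexify uD uZ ule1.
exists g; split => //.
have uN : u (- x) = - u x.
  by rewrite -scaleN1r -(rmorph1 ofR) -rmorphN uZ mulN1r.
have xu : re `|x| <= u x.
  by have := ule (- x); have := tilt_opp x sn; rewrite uN; lra.
rewrite -(ofR_re_norm x) (le_trans _ (re_le_norm _))// ofR_le gu.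
exact: le_trans (ler_norm _).
Qed.

Lemma canon_norm (x : X) : `|canon x| = `|x|.
Proof.
apply/eqP; rewrite eq_le; apply/andP; split.
  by apply: dual_le_bound => // f; rewrite mulrC; exact: (dual_le f x).
have [g [g1 xg]] := norming_functional x.
apply: (le_trans xg); have : `|g x| <= _ := dual_le (canon x) g.
move=> /le_trans; apply.
by rewrite -[leRHS]mulr1 ler_wpM2l.
Qed.

End HahnBanach.

(** * Weak and weak* topologies *)

Lemma ultra_fmap (S U : Type) (f : S -> U) (F : set_system S) :
  UltraFilter F -> UltraFilter (f @ F).
Proof.
move=> FU; split; first exact: fmap_proper_filter.
move=> G GF sFG; rewrite predeqE => A; split; last exact: sFG.
move=> GA; have [//|FnA] := in_ultra_setVsetC (f @^-1` A) FU.
have GnA : G (~` A) by exact: sFG.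
by have /filter_ex[? []] : G (A `&` ~` A) by exact: filterI.
Qed.

Section Pointwise.
Context {R : realType} {s : scalar_kind}.
Local Notation K := (scalar_field R s).
Variables (S : choiceType) (I : Type) (e : S -> I -> K^o).
Local Notation W := (initial_topology (fun a => e a : {ptws I -> K^o})).

(** The weak and the w*-topology are both of this form; afterwards they are
    handled through pointwise convergence only. *)
Lemma ptwise_cvg (F : set_system S) (a : S) : Filter F ->
  F --> (a : W) <-> forall i, e ^~ i @ F --> e a i.
Proof.
move=> FF; split=> [Fa i A|Fi].
  rewrite nbhsE => -[B [oB Bea] BA].
  rewrite /= nbhs_simpl; apply: Fa.
  pose P : set {ptws I -> K^o} := [set g | B (g i)].
  have oP : open P.
    rewrite openE => g Bgi.
    have /cvg_sup cg : nbhs g --> g by [].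
    apply: (cg i).
    apply: open_nbhs_nbhs; split=> //.
    by exists B.
  apply: (@filterS _ _ _ ((fun a => e a : {ptws I -> K^o}) @^-1` P)).
    by move=> b; exact: BA.
  by apply: open_nbhs_nbhs; split => //; exists P.
move=> A; rewrite nbhsE => -[_ [[V oV <-] Vea] VA].
rewrite nbhs_simpl; apply: filterS VA _.
have : ((fun a => e a : {ptws I -> K^o}) @ F) --> (e a : {ptws I -> K^o}).
  apply/cvg_sup => i B.
  rewrite nbhsE => -[_ [[C oC <-] Cea] CB].
  rewrite /= nbhs_simpl; apply: filterS => [b|]; first exact: CB.
  by apply: (Fi i); apply: open_nbhs_nbhs.
by apply; apply: open_nbhs_nbhs.
Qed.

End Pointwise.

Section WeakStar.
Context {R : realType} {s : scalar_kind}.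
Local Notation K := (scalar_field R s).
Implicit Types X Y : normedModType K.

Lemma weak_star_cvg X (F : set_system (dual X)) (f : dual X) : Filter F ->
  F --> (f : weak_star X) <->
  forall x, (fun g : dual X => g x : K^o) @ F --> f x.
Proof. exact: ptwise_cvg. Qed.

Lemma weak_cvg X (F : set_system X) (x : X) : Filter F ->
  F --> (x : weak X) <-> forall f : dual X, (fun z => f z : K^o) @ F --> f x.
Proof. exact: (ptwise_cvg (fun x (f : dual X) => f x)). Qed.

Lemma weak_star_eval_continuous X (x : X) :
  continuous ((fun f => f x : K^o) : weak_star X -> K^o).
Proof.
move=> f; have [+ _] := @weak_star_cvg X (nbhs (f : weak_star X)) f _.
by move=> /(_ (fun _ => id)); apply.
Qed.

Lemma weak_star_continuous (T : topologicalType) X (h : T -> dual X) :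
  (forall x, continuous ((fun t => h t x : K^o) : T -> K^o)) ->
  continuous (h : T -> weak_star X).
Proof. by move=> hc t; apply/weak_star_cvg => x; exact: hc. Qed.

Lemma weak_continuous (T : topologicalType) X (h : T -> X) :
  (forall f : dual X, continuous ((fun t => f (h t) : K^o) : T -> K^o)) ->
  continuous (h : T -> weak X).
Proof. by move=> hc t; apply/weak_cvg => f; exact: hc. Qed.

Lemma weak_eval_continuous X (f : dual X) :
  continuous ((fun x => f x : K^o) : weak X -> K^o).
Proof.
move=> x; have [+ _] := @weak_cvg X (nbhs (x : weak X)) x _.
by move=> /(_ (fun _ => id)); apply.
Qed.

Lemma weak_star_hausdorff X : hausdorff_space (weak_star X).
Proof.
move=> f g fg; apply: dual_eqP => x.
apply: (@norm_hausdorff K K^o) => A B Af Bg.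
have [h [Ah Bh]] :=
  fg _ _ (weak_star_eval_continuous Af) (weak_star_eval_continuous Bg).
by exists (h x).
Qed.

(** Functionals separate points, by the Hahn-Banach theorem. *)
Lemma weak_hausdorff X : hausdorff_space (weak X).
Proof.
move=> x y xy; apply/eqP; rewrite -subr_eq0 -normr_le0.
have [g [_ gxy]] := norming_functional (x - y).
apply: (le_trans gxy); rewrite normr_le0.
have gE : g x = g y.
  apply: (@norm_hausdorff K K^o) => A B Ax By.
  have [z [Az Bz]] :=
    xy _ _ (weak_eval_continuous Ax) (weak_eval_continuous By).
  by exists (g z).
by rewrite addrC -scaleN1r dual_linear gE scaleN1r addNr.
Qed.

(** The sets described on the right form a filter that converges pointwise to f,
    so it is finer than the neighbourhood filter. *)
Lemma weak_star_nbhs X (f : dual X) (U : set (weak_star X)) :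
  nbhs (f : weak_star X) U ->
  exists (zs : seq X) (e : R), 0 < e /\
    forall g : dual X, (forall z, z \in zs -> `|f z - g z| < ofR e) -> U g.
Proof.
pose F : set_system (dual X) := [set A | exists (zs : seq X) (e : R), 0 < e /\
    forall g : dual X, (forall z, z \in zs -> `|f z - g z| < ofR e) -> A g].
have FF : Filter F.
  split.
  - by exists [::], 1.
  - move=> A B [zs [e [e0 HA]]] [zs' [e' [e'0 HB]]].
    exists (zs ++ zs'), (Num.min e e'); split; first by rewrite lt_min e0.
    move=> g Hg; split; [apply: HA|apply: HB] => z zz.
      have := Hg z; rewrite mem_cat zz => /(_ isT) /lt_le_trans; apply.
      by rewrite ofR_le ge_min lexx.
    have := Hg z; rewrite mem_cat zz orbT => /(_ isT) /lt_le_trans; apply.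
    by rewrite ofR_le ge_min lexx orbT.
  - by move=> A B AB [zs [e [e0 HA]]]; exists zs, e; split => // g /HA /AB.
have [_ cF] := weak_star_cvg f FF.
suff /cF cFf : forall x, (fun g : dual X => g x : K^o) @ F --> f x.
  by move=> /cFf.
move=> x; apply/cvgrPdist_lt => e e0; exists [:: x], (re e); split.
  by rewrite -(ofR_lt (s := s)) rmorph0 ge0_ofR// ltW.
by move=> g /(_ x (mem_head _ _)); rewrite ge0_ofR// ltW.
Qed.

(** Banach-Alaoglu theorem. Along an ultrafilter on the ball the values at each x
    stay in a compact disc, hence converge; the limits form a functional in the
    ball. *)
Lemma dual_ball_compact X (M : K) :
  compact ([set f | `|f| <= M] : set (weak_star X)).
Proof.
rewrite compact_ultra => F UF FM.
have PF := @ultra_proper _ _ UF.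
have evF x : exists c : K^o,
      (fun f : dual X => f x : K^o) @ F --> c /\ `|c| <= M * `|x|.
  have := @disc_compact R s (M * `|x|); rewrite compact_ultra.
  move=> /(_ _ (ultra_fmap (fun f : dual X => f x : K^o) UF)) [|c [cM Fc]].
    pose D (f : dual X) := `|f x| <= M * `|x|.
    apply: (@filterS _ F _ _ D _ FM) => f /= fM; rewrite /D.
    change (`|(f : dual X) x| <= M * `|x|).
    by apply: (le_trans (dual_le _ _)); rewrite ler_wpM2r.
  by exists c.
have [L LP] := choice evF; have LF x := (LP x).1.
have lL : linear (L : X -> K^o).
  move=> a x y; apply: (@cvg_unique _ (@norm_hausdorff K K^o) _ _ _ _ (LF _)).
  have -> : (fun f : dual X => f (a *: x + y) : K^o) =
      (fun f : dual X => a *: (f x : K^o) + (f y : K^o)).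
    by apply/funext => f; rewrite dual_linear.
  by apply: cvgD; [apply: cvgZr|].
have M0 : 0 <= M.
  by have [f /= fM] := filter_ex FM; exact: le_trans (normr_ge0 f) fM.
have bL : bounded_linear (L : X -> K^o).
  by split=> //; exists M => x; exact: (LP x).2.
exists (mk_dual bL); split; last by apply/weak_star_cvg => x; exact: LF.
by apply: dual_le_bound => // x; exact: (LP x).2.
Qed.

End WeakStar.

(** * Weak*-continuous functionals are evaluations *)

Section Evaluation.
Context {R : realType} {s : scalar_kind}.
Local Notation K := (scalar_field R s).
Implicit Types X Y : normedModType K.

Lemma dualD X (f : dual X) : {morph f : x y / x + y}.
Proof. by move=> x y; rewrite -[x in LHS]scale1r dual_linear scale1r. Qed.

Lemma dualN X (f : dual X) : {morph f : x / - x}.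
Proof. by move=> x; rewrite -scaleN1r dualZ mulN1r. Qed.

Lemma dualB X (f : dual X) : {morph f : x y / x - y}.
Proof. by move=> x y; rewrite dualD dualN. Qed.

Lemma dual_addE X (f g : dual X) x : (f + g) x = f x + g x :> K.
Proof. by []. Qed.

Lemma dual_scaleE X (a : K) (f : dual X) x : (a *: f) x = a * f x :> K.
Proof. by []. Qed.

(** A functional that vanishes on the common kernel of finitely many evaluations
    is a linear combination of them. The inductive step removes from phi its
    component along z, using some g0 that is 1 at z and vanishes on the other
    points; if no such g0 exists, z is redundant. *)
Lemma eval_of_kernel X (zs : seq X) (phi : dual X -> K) :
  (forall a f g, phi (a *: f + g) = a * phi f + phi g) ->
  (forall g : dual X, (forall z, z \in zs -> g z = 0) -> phi g = 0) ->
  exists x, forall g : dual X, phi g = g x.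
Proof.
elim: zs phi => [|z zs IH] phi lphi kphi.
  by exists 0 => g; rewrite dual0 kphi.
have [[g0 [g0z g0zs]]|no] := pselect (exists g0 : dual X,
    g0 z = 1 /\ forall y, y \in zs -> g0 y = 0).
  have [|g gzs|x phiE] := IH (fun g => phi g - phi g0 * g z).
  - move=> a f g.
    rewrite dual_addE dual_scaleE lphi; ring.
  - have -> : phi g = phi (g z *: g0 + (- g z *: g0 + g)).
      by rewrite addrA -scalerDl subrr scale0r add0r.
    rewrite lphi (kphi (- g z *: g0 + g)) ?addr0 ?[_ * g z]mulrC ?subrr// => y.
    rewrite dual_addE dual_scaleE inE => /predU1P[->|yzs].
      by rewrite g0z mulr1 addNr.
    by rewrite g0zs// (gzs y)// mulr0 addr0.
  exists (x + phi g0 *: z) => g.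
  by rewrite dualD dualZ -phiE subrK.
apply: IH => // g gzs; apply: kphi => y; rewrite inE => /predU1P[->|/gzs//].
have [//|gz0] := eqVneq (g z) 0; exfalso; apply: no.
exists ((g z)^-1 *: g); split=> [|y' y'zs].
  by rewrite dual_scaleE mulVf.
by rewrite dual_scaleE (gzs y')// mulr0.
Qed.

(** Continuity at 0 bounds phi by 1 on a basic neighbourhood of 0, which
    contains the common kernel of finitely many evaluations; on that subspace phi
    is bounded, hence zero. *)
Lemma weak_star_continuous_eval X (phi : dual X -> K) :
  (forall a f g, phi (a *: f + g) = a * phi f + phi g) ->
  continuous (phi : weak_star X -> K^o) ->
  exists x, forall g : dual X, phi g = g x.
Proof.
move=> lphi cphi.
have phi0 : phi 0 = 0.
  by have := lphi (-1) 0 0; rewrite scaler0 addr0 mulN1r addNr.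
have phiZ a g : phi (a *: g) = a * phi g.
  by rewrite -[a *: g]addr0 lphi phi0 addr0.
have : nbhs (0 : weak_star X) [set g | `|phi g| < 1].
  have := @cphi 0 [set c | `|c| < 1]; apply; rewrite phi0.
  have := nbhsx_ballx (0 : K^o) 1 ltr01; apply: filterS => c.
  by rewrite -ball_normE /= sub0r normrN.
move=> /weak_star_nbhs[zs [e [e0 He]]].
apply: (@eval_of_kernel X zs) => // g gzs.
have [//|pg] := eqVneq (phi g) 0.
have : `|phi ((phi g)^-1 *: g)| < 1.
  apply: He => z zz; rewrite [X in `|X - _|]/(0 : K).
  rewrite dual_scaleE gzs// mulr0 subr0 normr0.
  by rewrite -(rmorph0 ofR) ofR_lt.
by rewrite phiZ mulVf// normr1 ltxx.
Qed.

End Evaluation.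

(** * Goldstine's theorem *)

Section Goldstine.
Context {R : realType} {s : scalar_kind}.
Local Notation K := (scalar_field R s).
Variable X : normedModType K.

Lemma dual_norm_approx (h : dual X) (d : R) : 0 < d ->
  exists x : X, `|x| <= 1 /\ re `|h| - d < re (h x).
Proof.
move=> d0; apply: contrapT => no.
have hle x : `|x| <= 1 -> re (h x) <= re `|h| - d.
  by move=> x1; rewrite leNgt; apply/negP => hx; apply: no; exists x.
have : `|h| <= ofR (re `|h| - d).
  apply: dual_norm_lub => x x1.
  have [->|hx0] := eqVneq (h x) 0.
    rewrite normr0 -(rmorph0 ofR) ofR_le.
    by have := hle 0; rewrite normr0 ler01 dual0 raddf0; apply.
  pose w := `|h x| / h x.
  have w1 : `|w| = 1 by rewrite normrM normfV normr_id mulfV// normr_eq0.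
  have hw : h (w *: x) = `|h x| by rewrite dualZ divfK.
  rewrite -(ofR_re_norm (h x)) ofR_le -hw; apply: hle.
  by rewrite normrZ w1 mul1r.
by rewrite -re_norm_le; lra.
Qed.

Lemma bidual_sum (xi : bidual X) (zs : seq (dual X)) (c : dual X -> K) :
  xi (\sum_(g <- zs) c g *: g) = \sum_(g <- zs) c g * xi g :> K.
Proof.
elim: zs => [|g zs IH]; first by rewrite !big_nil dual0.
by rewrite !big_cons dualD dualZ IH.
Qed.

(** Helly's lemma, by least squares. Let q(x) be the sum of |xi g - g x|^2 and d
    its infimum over the unit ball, and suppose d > 0. At a near-minimizer x, put
    h = sum of conj(xi g - g x) g; then re (xi h) = q(x) + re (h x), while
    re (xi h) <= |h|. So some x' in the ball has re (h (x' - x)) > d / 2, and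
    a small step from x towards x' brings q below d. *)
Lemma helly (zs : seq (dual X)) (xi : bidual X) (e : R) :
  `|xi| <= 1 -> 0 < e ->
  exists x : X, `|x| <= 1 /\ forall g, g \in zs -> `|xi g - g x| < ofR e.
Proof.
move=> xi1 e0.
pose q (x : X) := \sum_(g <- zs) re `|xi g - g x| ^+ 2.
have [[x [x1 qx]]|noq] := pselect (exists x, `|x| <= 1 /\ q x < e ^+ 2).
  exists x; split=> // g gzs.
  rewrite -(ofR_re_norm (xi g - g x)) ofR_lt.
  rewrite -(ltr_pXn2r (n := 2)) ?nnegrE//; last 2 first.
  - by rewrite -(ofR_le (s := s)) rmorph0 ofR_re_norm.
  - exact: ltW.
  apply: le_lt_trans qx; rewrite /q (big_rem g)//= lerDl.
  by apply: sumr_ge0 => *; exact: sqr_ge0.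
have qge x : `|x| <= 1 -> e ^+ 2 <= q x.
  by move=> x1; rewrite leNgt; apply/negP => qx; apply: noq; exists x.
pose Q := [set q x | x in [set x | `|x| <= 1]].
have Q0 : Q !=set0 by exists (q 0), 0; rewrite /= ?normr0.
have lQ : lbound Q (e ^+ 2) by move=> _ [x x1 <-]; exact: qge.
pose d := inf Q.
have dle x : `|x| <= 1 -> d <= q x.
  by move=> x1; apply: ge_inf; [exists (e ^+ 2)|exists x].
have d0 : 0 < d by apply: (lt_le_trans (exprn_gt0 2 e0)); exact: lb_le_inf.
pose S := \sum_(g <- zs) (2 * re `|g|) ^+ 2.
have S0 : 0 <= S by apply: sumr_ge0 => *; exact: sqr_ge0.
(* The step length: it keeps the second-order term t^2 S below t d / 2. *)
pose t := d / (2 * S + d).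
have D0 : 0 < 2 * S + d by lra.
have t0 : 0 < t by rewrite divr_gt0.
have t1 : t <= 1 by rewrite ler_pdivrMr//; lra.
have tS : 2 * (t * S) <= d.
  have tD : t * (2 * S + d) = d by rewrite divfK// gt_eqF.
  by have := mulr_gt0 t0 d0; lra.
have td0 : 0 < t * d by rewrite mulr_gt0.
have [_ [x /= x1 <-] qx] : exists2 r, Q r & r < d + t * d / 4.
  by apply: inf_adherent; [lra|split=> //; exists (e ^+ 2)].
pose v g := xi g - g x.
pose h := \sum_(g <- zs) cj (v g) *: g.
have hE y : h y = \sum_(g <- zs) cj (v g) * g y :> K.
  exact: (bidual_sum (canon y)).
have xih : re (xi h) = q x + re (h x).
  rewrite hE bidual_sum !raddf_sum /q -big_split /=.
  apply: eq_bigr => g _; rewrite -cj_mul_norm -/(v g) -raddfD -mulrDr /=.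
  by rewrite /v subrK.
have xihle : re (xi h) <= re `|h|.
  rewrite -(ofR_le (s := s)) ofR_re_norm.
  apply: (@le_trans _ _ (ofR `|re (xi h)|)); first by rewrite ofR_le ler_norm.
  apply: (le_trans (re_le_norm _)); apply: (le_trans (dual_le _ _)).
  by rewrite -[leRHS]mul1r ler_wpM2r.
have d20 : 0 < d / 2 by lra.
have [x' [x'1 hx']] := dual_norm_approx h d20.
have hdiff : d / 2 < re (h (x' - x)).
  rewrite dualB raddfB /=; have := dle x x1; lra.
pose xt := x + ofR t *: (x' - x).
have xt1 : `|xt| <= 1.
  have -> : xt = ofR (1 - t) *: x + ofR t *: x'.
    by rewrite /xt scalerBr rmorphB rmorph1 scalerBl scale1r addrAC addrA.
  apply: (le_trans (ler_normD _ _)); rewrite !normrZ !norm_ofR.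
  rewrite !ger0_norm; [|lra..].
  have -> : 1 = ofR (1 - t) + ofR t :> K by rewrite -rmorphD subrK rmorph1.
  by apply: lerD; rewrite -[leRHS]mulr1 ler_wpM2l// -(rmorph0 ofR) ofR_le; lra.
have qxt : q xt = q x - 2 * t * re (h (x' - x)) +
    t ^+ 2 * \sum_(g <- zs) re `|g (x' - x)| ^+ 2.
  rewrite hE raddf_sum !mulr_sumr.
  rewrite -sumrN -!big_split /=; apply: eq_bigr => g _.
  have -> : g xt = g x + ofR t * g (x' - x) :> K.
    by rewrite /xt (dualD g x) dualZ.
  by rewrite opprD addrA sqr_normB.
have sle : \sum_(g <- zs) re `|g (x' - x)| ^+ 2 <= S.
  apply: ler_sum => g _; rewrite ler_pXn2r ?nnegrE//.
  - rewrite re_norm_le rmorphM /= ofR_re_norm mulrC.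
    apply: (le_trans (dual_le _ _)); rewrite ler_wpM2l//.
    apply: (le_trans (ler_normB _ _)); rewrite (natrD _ 1 1) rmorphD rmorph1.
    exact: lerD.
  - by rewrite -(ofR_le (s := s)) rmorph0 ofR_re_norm.
  - by rewrite mulr_ge0// -(ofR_le (s := s)) rmorph0 ofR_re_norm.
have := dle xt xt1; rewrite qxt.
have t20 : 0 <= t ^+ 2 by exact: sqr_ge0.
have := ler_wpM2l t20 sle.
have := ltr_pM2l t0 (d / 2) (re (h (x' - x))); rewrite hdiff => tdiff.
have tSS : t * (2 * (t * S)) <= t * d by rewrite ler_pM2l.
rewrite expr2 in t20 *; lra.
Qed.

Lemma goldstine (xi : bidual X) : `|xi| <= 1 ->
  closure (@canon R s X @` [set x | `|x| <= 1] : set (weak_star (dual X))) xi.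
Proof.
move=> xi1 U /weak_star_nbhs[zs [e [e0 HU]]].
have [x [x1 xzs]] := helly zs xi1 e0.
by exists (canon x); split; [exists x|exact: HU].
Qed.

End Goldstine.

(** * Gantmacher's theorem *)

Section Gantmacher.
Context {R : realType} {s : scalar_kind}.
Local Notation K := (scalar_field R s).
Implicit Types X Y : normedModType K.

Lemma canonB X : {morph @canon R s X : x y / x - y}.
Proof. by move=> x y; apply: dual_eqP => g; rewrite [LHS](dualB g). Qed.

Lemma canon_inj X : injective (@canon R s X).
Proof.
move=> x y xy; apply/eqP; rewrite -subr_eq0 -normr_eq0 -canon_norm canonB xy.
by rewrite subrr normr0.
Qed.

Lemma canon_continuous X :
  continuous (@canon R s X : weak X -> weak_star (dual X)).
Proof. by apply: weak_star_continuous => g; exact: weak_eval_continuous. Qed.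

Lemma transpose_subproof X Y (T : X -> Y) (g : dual Y) :
  bounded_linear T -> bounded_linear (fun x => g (T x) : K^o).
Proof.
move=> [lT [M TM]]; split=> [a u v|]; first by rewrite lT dual_linear.
exists (`|g| * M) => x; rewrite (le_trans (dual_le _ _))// -mulrA.
by rewrite ler_wpM2l.
Qed.

Definition transpose X Y (T : X -> Y) (bT : bounded_linear T) (g : dual Y) :
  dual X := mk_dual (transpose_subproof g bT).

Lemma transpose_bounded X Y (T : X -> Y) (bT : bounded_linear T) :
  bounded_linear (transpose bT).
Proof.
split=> [a u v|]; first exact: dual_eqP.
have [lT [M TM]] := bT; exists `|M| => g.
apply: dual_le_bound => [|x]; first by rewrite mulr_ge0.
rewrite (le_trans (dual_le g (T x)))// [`|M| * _]mulrC -mulrA ler_wpM2l//.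
exact: le_norm_bound.
Qed.

Section Operator.
Variables (X Y : normedModType K) (T : X -> Y) (bT : bounded_linear T).

Definition bitranspose : bidual X -> bidual Y :=
  transpose (transpose_bounded bT).

Lemma bitranspose_canon x : bitranspose (canon x) = canon (T x).
Proof. exact: dual_eqP. Qed.

Lemma bitranspose_continuous :
  continuous (bitranspose : weak_star (dual X) -> weak_star (dual Y)).
Proof.
apply: weak_star_continuous => g.
exact: (@weak_star_eval_continuous _ _ _ (transpose bT g)).
Qed.

(** The canonical image of the weak closure C of T(ball) is w*-compact, hence
    w*-closed. By Goldstine's theorem xi is a w*-limit of points of the ball, so
    T^** xi is a w*-limit of points of T(ball). *)
Lemma weakly_compact_bitranspose_ball : weakly_compact T ->
  forall xi, `|xi| <= 1 -> exists y, bitranspose xi = canon y.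
Proof.
move=> cT xi xi1; pose C := closure (T @` [set x | `|x| <= 1] : set (weak Y)).
have cC : compact (@canon R s Y @` C : set (weak_star (dual Y))).
  apply: continuous_compact cT; apply: continuous_subspaceT.
  exact: canon_continuous.
have clC := compact_closed (@weak_star_hausdorff _ _ _) cC.
suff /clC[y _ <-] : closure (@canon R s Y @` C : set (weak_star (dual Y)))
    (bitranspose xi) by exists y.
move=> U /bitranspose_continuous/(goldstine xi1)[_ [[x x1 <-] Ux]].
exists (bitranspose (canon x)); split=> //; rewrite bitranspose_canon.
by exists (T x) => //; apply: subset_closure; exists x.
Qed.

(** For the converse, T^** read as a map X^** -> Y is continuous from the
    w*-topology to the weak one, so it maps the unit ball of X^** to a weakly
    compact, hence closed, set that contains T(ball). *)
Lemma weakly_compactP : weakly_compact T <->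
  forall xi, exists y, bitranspose xi = canon y.
Proof.
split=> [cT xi|Tc].
  have [->|xi0] := eqVneq xi 0.
    by exists 0; apply: dual_eqP => g; rewrite [RHS](dual0 g).
  have n0 : `|xi| != 0 by rewrite normr_eq0.
  have [|y Ty] := weakly_compact_bitranspose_ball cT (xi := `|xi|^-1 *: xi).
    by rewrite normrZ normfV normr_id mulVf.
  exists (`|xi| *: y); apply: dual_eqP => g.
  have E : `|xi|^-1 * bitranspose xi g = g y :> K.
    exact: (congr1 (fun h : bidual Y => h g : K) Ty).
  by rewrite [RHS](dualZ g) -E mulVKf.
have [S ST] := choice Tc.
have cS : continuous (S : weak_star (dual X) -> weak Y).
  apply: weak_continuous => g.
  have -> : (fun xi => g (S xi) : K^o) = (fun xi => xi (transpose bT g) : K^o).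
    apply/funext => xi; have := congr1 (fun h : bidual Y => h g : K) (ST xi).
    by move=> /= ->.
  exact: weak_star_eval_continuous.
pose B : set (weak_star (dual X)) := [set xi | `|xi| <= 1].
have cSB : compact (S @` B : set (weak Y)).
  apply: continuous_compact; first exact: continuous_subspaceT.
  exact: dual_ball_compact.
have clSB := compact_closed (@weak_hausdorff _ _ _) cSB.
apply: (subclosed_compact _ cSB); first exact: closed_closure.
apply: (subset_trans _ clSB); apply: closure_subset => _ [x x1 <-].
exists (canon x); first by rewrite /B /= canon_norm.
by apply: canon_inj; rewrite -ST bitranspose_canon.
Qed.

End Operator.
End Gantmacher.

(** * Separately weak*-continuous extensions *)

Section Extensions.
Context {R : realType} {s : scalar_kind}.
Local Notation K := (scalar_field R s).
Implicit Types X Y : normedModType K.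

Definition evaluation X (phi : bidual X -> K) : Prop :=
  exists g : dual X, forall xi, phi xi = xi g.

Lemma evaluation_ext X (phi psi : bidual X -> K) :
  evaluation phi -> evaluation psi ->
  (forall x, phi (canon x) = psi (canon x)) -> phi =1 psi.
Proof.
move=> [g phiE] [h psiE] pp xi; rewrite phiE psiE; congr (xi _).
by apply: dual_eqP => x; have := pp x; rewrite phiE psiE.
Qed.

(** Separate w*-continuity in algebraic form, for maps that are not bundled as
    trilinear ones so that their variables can be permuted freely. *)
Definition separately_evaluation (X1 X2 X3 Y : normedModType K)
    (F : bidual X1 -> bidual X2 -> bidual X3 -> bidual Y) : Prop :=
  forall y, [/\ forall x2 x3, evaluation (fun x1 => F x1 x2 x3 y),
    forall x1 x3, evaluation (fun x2 => F x1 x2 x3 y) &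
    forall x1 x2, evaluation (fun x3 => F x1 x2 x3 y)].

Lemma weak_star_continuous_evaluationP X Y (h : bidual X -> bidual Y) :
  linear h ->
  continuous (h : weak_star (dual X) -> weak_star (dual Y)) <->
  forall y, evaluation (fun xi => h xi y).
Proof.
move=> lh; split=> [ch y|hy]; last first.
  apply: weak_star_continuous => y; have [g hg] := hy y.
  have -> : (fun xi => h xi y : K^o) = (fun xi => xi g : K^o) by exact/funext.
  exact: weak_star_eval_continuous.
apply: weak_star_continuous_eval => [a u v|]; first by rewrite lh.
move=> xi.
exact: (continuous_comp (ch xi) (@weak_star_eval_continuous _ _ _ y (h xi))).
Qed.

Section Trilinear.
Variables (X1 X2 X3 Y : normedModType K) (f : trilinear_map X1 X2 X3 Y).

Lemma separately_weak_star_continuousP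
    (F : trilinear_map (bidual X1) (bidual X2) (bidual X3) (bidual Y)) :
  separately_weak_star_continuous F <-> separately_evaluation F.
Proof.
split=> [[c1 c2 c3] y|eF]; split=> u v.
- exact: (weak_star_continuous_evaluationP (tri_linear1 F u v)).1.
- exact: (weak_star_continuous_evaluationP (tri_linear2 F u v)).1.
- exact: (weak_star_continuous_evaluationP (tri_linear3 F u v)).1.
- apply: (weak_star_continuous_evaluationP (tri_linear1 F u v)).2 => y.
  by have [+ _ _] := eF y; apply.
- apply: (weak_star_continuous_evaluationP (tri_linear2 F u v)).2 => y.
  by have [_ + _] := eF y; apply.
- apply: (weak_star_continuous_evaluationP (tri_linear3 F u v)).2 => y.
  by have [_ _ +] := eF y; apply.
Qed.

Lemma tri_ext_canon x1 x2 x3 :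
  tri_ext f (canon x1) (canon x2) (canon x3) = canon (f x1 x2 x3).
Proof. exact: dual_eqP. Qed.

Lemma tri_ext_evaluation1 x2 x3 y : evaluation (fun x1 => tri_ext f x1 x2 x3 y).
Proof. by exists (tri_adj (tri_adj (tri_adj f)) x2 x3 y). Qed.

(** The variables are released from the canonical image one at a time, the third
    first and the first last, which is the order in which f^⊛ is an evaluation
    in them. *)
Lemma tri_ext_unique (F : bidual X1 -> bidual X2 -> bidual X3 -> bidual Y) :
  (forall x1 x2 x3, F (canon x1) (canon x2) (canon x3) = canon (f x1 x2 x3)) ->
  separately_evaluation F -> forall x1 x2 x3, F x1 x2 x3 = tri_ext f x1 x2 x3.
Proof.
move=> Ff eF x1 x2 x3; apply: dual_eqP => y; have [e1 e2 e3] := eF y.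
apply: (evaluation_ext (e1 x2 x3) (tri_ext_evaluation1 _ _ _)) => a.
have t2 : evaluation (fun x2 => tri_ext f (canon a) x2 x3 y).
  by exists (tri_adj (tri_adj f) x3 y a).
apply: (evaluation_ext (e2 _ _) t2) => b.
have t3 : evaluation (fun x3 => tri_ext f (canon a) (canon b) x3 y).
  by exists (tri_adj f y a b).
by apply: (evaluation_ext (e3 _ _) t3) => c; rewrite Ff.
Qed.

End Trilinear.

Section Norm.

Lemma tri_norm_ub (X1 X2 X3 Y : normedModType K)
    (f : trilinear_map X1 X2 X3 Y) x1 x2 x3 :
  `|x1| <= 1 -> `|x2| <= 1 -> `|x3| <= 1 -> `|f x1 x2 x3| <= tri_norm f.
Proof.
by move=> *; have [+ _] := tri_norm_sup f; apply; exists x1, x2, x3.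
Qed.

Lemma tri_norm_lub (X1 X2 X3 Y : normedModType K)
    (f : trilinear_map X1 X2 X3 Y) (M : K) :
  (forall x1 x2 x3, `|x1| <= 1 -> `|x2| <= 1 -> `|x3| <= 1 ->
    `|f x1 x2 x3| <= M) -> tri_norm f <= M.
Proof.
move=> fM; have [_] := tri_norm_sup f; apply.
by move=> _ [x1 [x2 [x3 [? ? ? ->]]]]; exact: fM.
Qed.

Lemma tri_adj_norm_le (X1 X2 X3 Y : normedModType K)
    (f : trilinear_map X1 X2 X3 Y) : tri_norm (tri_adj f) <= tri_norm f.
Proof.
apply: tri_norm_lub => y x1 x2 y1 ? ?; apply: dual_norm_lub => x3 ?.
apply: (le_trans (dual_le y (f x1 x2 x3))); rewrite -[leRHS]mul1r.
by apply: ler_pM => //; exact: tri_norm_ub.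
Qed.

Lemma tri_ext_norm (X1 X2 X3 Y : normedModType K)
    (f : trilinear_map X1 X2 X3 Y) : tri_norm (tri_ext f) = tri_norm f.
Proof.
apply/eqP; rewrite eq_le; apply/andP; split.
  by do 4 apply: (le_trans (tri_adj_norm_le _)).
apply: tri_norm_lub => x1 x2 x3 ? ? ?; rewrite -canon_norm -tri_ext_canon.
by apply: tri_norm_ub; rewrite canon_norm.
Qed.

End Norm.

(** * Permuted extensions *)

Section Permutations.
Variables (X1 X2 X3 Y : normedModType K) (f : trilinear_map X1 X2 X3 Y).
Local Notation X := (space3 X1 X2 X3).
Local Notation bitriple := (triple (G := fun Z => bidual Z)).

Ltac by_variable e1 e2 e3 :=
  first [exact: e1 | exact: e2 | exact: e3].

(** The values sigma(1), sigma(2), sigma(3) are replaced by variables i, j, k, so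
    that a case analysis computes the types of g in each of the six cases. *)
Lemma perm_tri_ext_unique (i j k : 'I_3)
    (g : trilinear_map (X i) (X j) (X k) Y) :
  uniq [:: i; j; k] ->
  (forall x : (forall l, X l), g (x i) (x j) (x k) = f (x i0) (x i1) (x i2)) ->
  separately_evaluation (tri_ext f) ->
  forall x1 x2 x3, let x := bitriple x1 x2 x3 in
    tri_ext g (x i) (x j) (x k) = tri_ext f x1 x2 x3.
Proof.
case: i j k g => [[|[|[|?]]] ?] // [[|[|[|?]]] ?] // [[|[|[|?]]] ?] // g _ gE;
  move=> ef x1 x2 x3 /=; symmetry.
- apply: (tri_ext_unique (f := g) (F := fun a b c => tri_ext f a b c)).
    move=> a b c; rewrite tri_ext_canon; congr canon.
    by rewrite -(gE (triple (G := fun Z => Z) a b c)).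
  by move=> y; have [e1 e2 e3] := ef y; split=> u v; by_variable e1 e2 e3.
- apply: (tri_ext_unique (f := g) (F := fun a b c => tri_ext f a c b)).
    move=> a b c; rewrite tri_ext_canon; congr canon.
    by rewrite -(gE (triple (G := fun Z => Z) a c b)).
  by move=> y; have [e1 e2 e3] := ef y; split=> u v; by_variable e1 e2 e3.
- apply: (tri_ext_unique (f := g) (F := fun a b c => tri_ext f b a c)).
    move=> a b c; rewrite tri_ext_canon; congr canon.
    by rewrite -(gE (triple (G := fun Z => Z) b a c)).
  by move=> y; have [e1 e2 e3] := ef y; split=> u v; by_variable e1 e2 e3.
- apply: (tri_ext_unique (f := g) (F := fun a b c => tri_ext f c a b)).
    move=> a b c; rewrite tri_ext_canon; congr canon.
    by rewrite -(gE (triple (G := fun Z => Z) c a b)).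
  by move=> y; have [e1 e2 e3] := ef y; split=> u v; by_variable e1 e2 e3.
- apply: (tri_ext_unique (f := g) (F := fun a b c => tri_ext f b c a)).
    move=> a b c; rewrite tri_ext_canon; congr canon.
    by rewrite -(gE (triple (G := fun Z => Z) b c a)).
  by move=> y; have [e1 e2 e3] := ef y; split=> u v; by_variable e1 e2 e3.
- apply: (tri_ext_unique (f := g) (F := fun a b c => tri_ext f c b a)).
    move=> a b c; rewrite tri_ext_canon; congr canon.
    by rewrite -(gE (triple (G := fun Z => Z) c b a)).
  by move=> y; have [e1 e2 e3] := ef y; split=> u v; by_variable e1 e2 e3.
Qed.

(** The extension of g is always an evaluation in its leading variable, here the
    second or the third one of f. *)
Lemma perm_tri_ext_evaluation (i j k : 'I_3)
    (g : trilinear_map (X i) (X j) (X k) Y) (y : dual Y) :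
  uniq [:: i; j; k] ->
  (i = i1 -> forall x1 x3, evaluation (fun x2 =>
     let x := bitriple x1 x2 x3 in tri_ext g (x i) (x j) (x k) y)) /\
  (i = i2 -> forall x1 x2, evaluation (fun x3 =>
     let x := bitriple x1 x2 x3 in tri_ext g (x i) (x j) (x k) y)).
Proof.
case: i j k g => [[|[|[|?]]] ?] // [[|[|[|?]]] ?] // [[|[|[|?]]] ?] // g _;
  split=> // _ u v; exact: (tri_ext_evaluation1 g).
Qed.

Lemma regular_separately_evaluation :
  aron_berner_regular f <-> separately_evaluation (tri_ext f).
Proof.
split=> [reg y|ef sigma x1 x2 x3]; last first.
  exact: (perm_tri_ext_unique (tri_perm_uniq sigma) (tri_permE f sigma)).
split=> [x2 x3|x1 x3|x1 x2]; first exact: tri_ext_evaluation1.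
- have [g gE] : evaluation (fun x2 =>
      aron_berner_ext f (tperm i0 i1) x1 x2 x3 y).
    have [+ _] := perm_tri_ext_evaluation (tri_perm f (tperm i0 i1)) y
      (tri_perm_uniq _).
    by rewrite {1}tpermL => /(_ erefl); apply.
  by exists g => x2; rewrite -gE reg.
have [g gE] : evaluation (fun x3 =>
    aron_berner_ext f (tperm i0 i2) x1 x2 x3 y).
  have [_] := perm_tri_ext_evaluation (tri_perm f (tperm i0 i2)) y
    (tri_perm_uniq _).
  by rewrite {1}tpermL => /(_ erefl); apply.
by exists g => x3; rewrite -gE reg.
Qed.

End Permutations.

(** * The conditions of the theorem *)

Section Conditions.
Variables (X1 X2 X3 Y : normedModType K) (f : trilinear_map X1 X2 X3 Y).

Definition adjoints_canonical : Prop :=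
  (forall (y : dual Y) (x1 : bidual X1) (x2 : bidual X2),
    exists x3 : dual X3, tri_adj (tri_ext f) (canon y) x1 x2 = canon x3) /\
  (forall (x3 : bidual X3) (y : dual Y) (x1 : bidual X1),
    exists x2 : dual X2,
      tri_adj (tri_adj (tri_ext f)) (canon x3) (canon y) x1 = canon x2).

Lemma adjoints_canonicalP :
  adjoints_canonical <-> separately_evaluation (tri_ext f).
Proof.
split=> [[c3 c2] y|ef]; split.
- by move=> x2 x3; exact: tri_ext_evaluation1.
- move=> x1 x3; have [g gE] := c2 x3 y x1; exists g => x2.
  exact: (congr1 (fun h : dual (bidual X2) => h x2 : K) gE).
- move=> x1 x2; have [g gE] := c3 y x1 x2; exists g => x3.
  exact: (congr1 (fun h : dual (bidual X3) => h x3 : K) gE).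
- move=> y x1 x2; have [_ _ /(_ x1 x2)[g gE]] := ef y.
  by exists g; exact: dual_eqP.
- move=> x3 y x1; have [_ /(_ x1 x3)[g gE] _] := ef y.
  by exists g; exact: dual_eqP.
Qed.

Lemma first_arens_adj (y : dual Y) x1 x2 :
  first_arens (tri_fix1 (tri_adj f) y) x1 x2 =
  tri_adj (tri_ext f) (canon y) x1 x2.
Proof.
apply: dual_eqP => x3; congr (x1 _); apply: dual_eqP => a; congr (x2 _).
by apply: dual_eqP => b; congr (x3 _); exact: dual_eqP.
Qed.

Lemma tri_adj2_bounded (x3 : bidual X3) (y : dual Y) :
  bounded_linear (tri_adj (tri_adj f) x3 y).
Proof.
split; first exact: tri_linear3.
have [M M0 fM] := tri_bound (tri_adj (tri_adj f)).
by exists (M * (`|x3| * `|y|)) => x1; rewrite -mulrA.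
Qed.

Lemma bitranspose_tri_adj2 (x3 : bidual X3) (y : dual Y) (x1 : bidual X1) :
  bitranspose (tri_adj2_bounded x3 y) x1 =
  tri_adj (tri_adj (tri_ext f)) (canon x3) (canon y) x1.
Proof.
by apply: dual_eqP => x2; congr (x1 _); exact: dual_eqP.
Qed.

Lemma adjoints_canonical_weakly_compactP : adjoints_canonical <->
  (forall y : dual Y, first_arens_valued (tri_fix1 (tri_adj f) y)) /\
  (forall (y : dual Y) (x3 : bidual X3),
    weakly_compact (fun x1 : X1 => tri_adj (tri_adj f) x3 y x1)).
Proof.
split=> -[c3 c2]; split.
- move=> y x1 x2; have [g gE] := c3 y x1 x2.
  by exists g; rewrite first_arens_adj.
- move=> y x3; apply: (weakly_compactP (tri_adj2_bounded x3 y)).2 => x1.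
  by rewrite bitranspose_tri_adj2; exact: c2.
- by move=> y x1 x2; have [g] := c3 y x1 x2; rewrite first_arens_adj; exists g.
- move=> x3 y x1; rewrite -bitranspose_tri_adj2.
  exact: ((weakly_compactP (tri_adj2_bounded x3 y)).1 (c2 y x3)).
Qed.

End Conditions.

End Extensions.

Theorem theorem2p6 (R : realType) (s : scalar_kind)
    (X1 X2 X3 Y : completeNormedModType (scalar_field R s))
    (f : trilinear_map X1 X2 X3 Y) :
  [<->
    (* (a) *)
    aron_berner_regular f;
    (* (b) *)
    exists F : trilinear_map (bidual X1) (bidual X2) (bidual X3) (bidual Y),
      [/\ forall x1 x2 x3,
            F (canon x1) (canon x2) (canon x3) = canon (f x1 x2 x3),
          tri_norm F = tri_norm f &
          separately_weak_star_continuous F];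
    (* (c) *)
    (forall (y : dual Y) (x1 : bidual X1) (x2 : bidual X2),
      exists x3 : dual X3, tri_adj (tri_ext f) (canon y) x1 x2 = canon x3) /\
    (forall (x3 : bidual X3) (y : dual Y) (x1 : bidual X1),
      exists x2 : dual X2,
        tri_adj (tri_adj (tri_ext f)) (canon x3) (canon y) x1 = canon x2);
    (* (d) *)
    (forall y : dual Y, first_arens_valued (tri_fix1 (tri_adj f) y)) /\
    (forall (y : dual Y) (x3 : bidual X3),
      weakly_compact (fun x1 : X1 => tri_adj (tri_adj f) x3 y x1))
  ].
Proof.
tfae.
- move=> /regular_separately_evaluation ef; exists (tri_ext f); split.
  + by move=> x1 x2 x3; exact: tri_ext_canon.
  + exact: tri_ext_norm.
  + exact/separately_weak_star_continuousP.
- move=> [F [Ff _ /separately_weak_star_continuousP eF]].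
  apply/adjoints_canonicalP => y.
  have FE := tri_ext_unique Ff eF; have [e1 e2 e3] := eF y.
  split=> u v.
  + by have [g gE] := e1 u v; exists g => x; rewrite -gE FE.
  + by have [g gE] := e2 u v; exists g => x; rewrite -gE FE.
  + by have [g gE] := e3 u v; exists g => x; rewrite -gE FE.
- by move/adjoints_canonical_weakly_compactP.
- move/adjoints_canonical_weakly_compactP/adjoints_canonicalP.
  by move/regular_separately_evaluation.
Qed.
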